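(* Let $D$ be an ABQR algebra of type $(\Omega,\Lambda)$ over $\mathbf{k}$. (1) Let $P$ be a Rota-Baxter operator of weight $\lambda\in\mathbf{k}$ on $D$. For each $\odot\in\Omega$, define binary operations on $D$ by $$x\left[{\odot\atop\prec}\right]y=x\odot P(y),\qquad x\left[{\odot\atop\succ}\right]y=P(x)\odot y,\qquad x\left[{\odot\atop\circ}\right]y=\lambda\,x\odot y.$$ Then these operations define an ABQR algebra on $D$ of type $(\Omega\otimes\Omega_T,\ \Lambda\,\square\,\Lambda_T)$, where $(\Omega_T,\Lambda_T)$ is the type of the dendriform trialgebra. (2) Let $N$ be a Nijenhuis operator on $D$. For each $\odot\in\Omega$, define binary operations on $D$ by $$x\left[{\odot\atop\prec}\right]y=x\odot N(y),\qquad x\left[{\odot\atop\succ}\right]y=N(x)\odot y,\qquad x\left[{\odot\atop\bullet}\right]y=-N(x\odot y).$$ Then these operations define an ABQR algebra on $D$ of type $(\Omega\otimes\Omega_N,\ \Lambda\,\square\,\Lambda_N)$, where $(\Omega_N,\Lambda_N)$ is the type of the NS-algebra. (3) Let $P$ be a left (resp. right) Rota-Baxter operator on $D$. For each $\odot\in\Omega$, define binary operations on $D$ by $$x\left[{\odot\atop\succ}\right]y=P(x)\odot y,\qquad x\left[{\odot\atop\star}\right]y=x\odot P(y)$$ $$\Big(\text{resp. } x\left[{\odot\atop\prec}\right]y=x\odot P(y),\qquad x\left[{\odot\atop\star}\right]y=P(x)\odot y\Big).$$ Then these operations define an ABQR algebra on $D$ of type $(\Omega\otimes\Omega_L,\ \Lambda\,\square\,\Lambda_L)$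 (resp. $(\Omega\otimes\Omega_R,\ \Lambda\,\square\,\Lambda_R)$), where $(\Omega_L,\Lambda_L)$ (resp. $(\Omega_R,\Lambda_R)$) is the type of the $L$-dipterous (resp. $L$-anti-dipterous) algebra.
   Context: $\mathbf{k}$ is a field of characteristic zero. A binary, quadratic, regular operad is identified with its type: a pair $(\Omega,\Lambda)$ with $\Omega$ a finite-dimensional $\mathbf{k}$-vector space and $\Lambda\subseteq\Omega^{\otimes 2}\oplus\Omega^{\otimes 2}$ a linear subspace. It is an ABQR operad if there is $\star\in\Omega$ with $(\star\otimes\star,\star\otimes\star)\in\Lambda$. An algebra of type $(\Omega,\Lambda)$ is a $\mathbf{k}$-vector space $A$ on which each $\odot\in\Omega$ acts as a bilinear operation $(x,y)\mapsto x\odot y$, depending linearly on $\odot$, such that for every $\big(\sum_i \odot^{(1)}_i\otimes\odot^{(2)}_i,\ \sum_j\odot^{(3)}_j\otimes\odot^{(4)}_j\big)\in\Lambda$ one has $\sum_i(x\odot^{(1)}_i y)\odot^{(2)}_i z=\sum_j x\odot^{(3)}_j(y\odot^{(4)}_j z)$ for all $x,y,z\in A$; it is an ABQR algebra when $(\Omega,\Lambda)$ is an ABQR operad. Square product: write $\left[{\odot_1\atop\odot_2}\right]:=\odot_1\otimes\odot_2\in\Omega_1\otimes\Omega_2$. For $f_i=(a_i\otimes b_i,\ c_i\otimes d_i)$, $i=1,2$, put $\left[{f_1\atop f_2}\right]=\left(\left[{a_1\atop a_2}\right]\otimes\left[{b_1\atop b_2}\right],\ \left[{c_1\atop c_2}\right]\otimes\left[{d_1\atop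 d_2}\right]\right)$, extended bilinearly to $f_i\in\Omega_i^{\otimes2}\oplus\Omega_i^{\otimes2}$ (that is, $((u_1,v_1),(u_2,v_2))\mapsto(\sigma(u_1\otimes u_2),\sigma(v_1\otimes v_2))$, $\sigma$ exchanging the second and third tensor factors). $\Lambda_1\,\square\,\Lambda_2$ is the span of all $\left[{f_1\atop f_2}\right]$ with $f_1\in\Lambda_1,f_2\in\Lambda_2$. Operations indexed by $\Omega\otimes\Omega'$ are defined on the elements $\left[{\odot\atop\odot'}\right]$, with $\odot'$ a basis element of $\Omega'$, and extended linearly. Operators: a linear operator $P$ on an ABQR algebra $D$ of type $(\Omega,\Lambda)$ is, if the respective identity holds for every $\odot\in\Omega$ and all $x,y\in D$: a Rota-Baxter operator of weight $\lambda\in\mathbf{k}$ if $P(x)\odot P(y)=P(P(x)\odot y+x\odot P(y)+\lambda x\odot y)$; a left Rota-Baxter operator if $P(x)\odot P(y)=P(x\odot P(y))$; a right Rota-Baxter operator if $P(x)\odot P(y)=P(P(x)\odot y)$. A linear operator $N$ is a Nijenhuis operator if $N(x)\odot N(y)=N(N(x)\odot y+x\odot N(y)-N(x\odot y))$ for every $\odot\in\Omega$ and all $x,y\in D$. Specific types (given by a basis of $\Omega$ and a spanning set of $\Lambda$): - Dendriform trialgebra $(\Omega_T,\Lambda_T)$: basis $\{\prec,\succ,\circ\}$, $\star=\prec+\succ+\circ$; relations $(\prec\otimes\prec,\prec\otimes\star)$, $(\succ\otimes\prec,\succ\otimes\prec)$, $(\star\otimes\succ,\succ\otimes\succ)$,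 $(\succ\otimes\circ,\succ\otimes\circ)$, $(\prec\otimes\circ,\circ\otimes\succ)$, $(\circ\otimes\prec,\circ\otimes\prec)$, $(\circ\otimes\circ,\circ\otimes\circ)$. - NS-algebra $(\Omega_N,\Lambda_N)$: basis $\{\prec,\succ,\bullet\}$, $\star=\prec+\succ+\bullet$; relations $(\prec\otimes\prec,\prec\otimes\star)$, $(\succ\otimes\prec,\succ\otimes\prec)$, $(\star\otimes\succ,\succ\otimes\succ)$, $(\star\otimes\bullet+\bullet\otimes\prec,\ \succ\otimes\bullet+\bullet\otimes\star)$. - $L$-dipterous algebra $(\Omega_L,\Lambda_L)$: basis $\{\star,\succ\}$; relations $(\star\otimes\star,\star\otimes\star)$, $(\star\otimes\succ,\succ\otimes\succ)$, $(\succ\otimes\star,\succ\otimes\star)$. - $L$-anti-dipterous algebra $(\Omega_R,\Lambda_R)$: basis $\{\star,\prec\}$; relations $(\star\otimes\star,\star\otimes\star)$, $(\prec\otimes\prec,\prec\otimes\star)$, $(\star\otimes\prec,\star\otimes\prec)$. *)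

(* Defs.v *)
From HB Require Import structures.
From mathcomp Require Import all_boot all_order all_algebra.

Set Implicit Arguments.
Unset Strict Implicit.
Unset Printing Implicit Defensive.

Import GRing.Theory.
Local Open Scope ring_scope.

(* The tensor product of two finite-dimensional spaces U and V is realised as  *)
(* the space of coefficient matrices over the products of the basis vectors    *)
(* chosen by [vbasis]; [tlift] is its universal property.                      *)

Section Tensor.

Variable k : fieldType.
Implicit Types U V : vectType k.

Definition tens U V : vectType k := 'M[k]_(\dim {:U}, \dim {:V}).

Definition tcoef U V (t : tens U V) : 'M[k]_(\dim {:U}, \dim {:V}) := t.

Definition tpure U V (u : U) (v : V) : tens U V :=
  \matrix_(i < \dim {:U}, j < \dim {:V})
    (coord (vbasis {:U}) i u * coord (vbasis {:V}) j v).

Definition bilin (U V W : lmodType k) (B : U -> V -> W) : Prop :=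
  (forall v, linear (fun u => B u v)) /\ (forall u, linear (B u)).

Definition tlift U V (W : lmodType k) (B : U -> V -> W) (t : tens U V) : W :=
  \sum_(i < \dim {:U}) \sum_(j < \dim {:V})
     tcoef t i j *: B (vbasis {:U})`_i (vbasis {:V})`_j.

Lemma lin_sum (U W : lmodType k) (f : U -> W) (I : finType) (c : I -> k)
    (u : I -> U) : linear f ->
  f (\sum_i c i *: u i) = \sum_i c i *: f (u i).
Proof.
move=> lf.
have f0 : f 0 = 0.
  have := lf 1 0 0; rewrite !scale1r addr0 => /eqP.
  by rewrite -subr_eq0 opprD addNKr oppr_eq0 => /eqP.
elim/big_rec2: _ => [|i y1 y2 _ <-]; first exact: f0.
by rewrite lf.
Qed.

Lemma tlift_is_linear U V (W : lmodType k) (B : U -> V -> W) :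
  linear (tlift B).
Proof.
move=> a s t; rewrite /tlift scaler_sumr -big_split; apply: eq_bigr => i _.
rewrite scaler_sumr -big_split; apply: eq_bigr => j _ /=.
by rewrite /tcoef !mxE scalerDl scalerA.
Qed.

Lemma tlift_pure U V (W : lmodType k) (B : U -> V -> W) u v :
  bilin B -> tlift B (tpure u v) = B u v.
Proof.
move=> [Bl Br]; rewrite [in RHS](coord_vbasis (memvf u)).
rewrite (lin_sum _ _ (Bl v)); apply: eq_bigr => i _.
rewrite [in RHS](coord_vbasis (memvf v)) (lin_sum _ _ (Br _)) scaler_sumr.
by apply: eq_bigr => j _; rewrite /tcoef mxE scalerA.
Qed.

Lemma tpure_bilin U V : bilin (@tpure U V).
Proof.
split=> [v | u] a x y; apply/matrixP=> i j; rewrite !mxE linearP /=.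
  by rewrite mulrDl mulrA.
by rewrite mulrDr mulrCA.
Qed.

Lemma tens_decomp U V (t : tens U V) :
  t = \sum_(i < \dim {:U}) \sum_(j < \dim {:V})
        tcoef t i j *: tpure (vbasis {:U})`_i (vbasis {:V})`_j.
Proof.
have fr (X : vectType k) : free (vbasis {:X}) by apply: basis_free (vbasisP _).
have E i j i' j' : tcoef t i' j' *
    tcoef (tpure (vbasis {:U})`_i' (vbasis {:V})`_j') i j =
    tcoef t i' j' * ((i' == i)%:R * (j' == j)%:R).
  by rewrite /tcoef mxE !coord_free.
apply/matrixP=> i j; rewrite summxE (bigD1 i) //= summxE (bigD1 j) //=.
rewrite mxE E !eqxx !mulr1 !big1 ?addr0 // => [i' ni|j' nj].
  by rewrite summxE big1 // => j' _; rewrite mxE E (negPf ni) mul0r mulr0.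
by rewrite mxE E (negPf nj) !mulr0.
Qed.

End Tensor.

Notation "u ⊗ v" := (tpure u v) (at level 40, left associativity).

(* The type (Omega, Lambda) of a binary, quadratic, regular operad.           *)

Definition quad (k : fieldType) (U : vectType k) : vectType k :=
  (tens U U * tens U U)%type.

Record bqr (k : fieldType) := BQR {
  bop : vectType k;
  brel : {vspace quad bop}
}.

Definition is_abqr (k : fieldType) (O : bqr k) : Prop :=
  exists s : bop O, (s ⊗ s, s ⊗ s) \in brel O.

Section Algebra.

Variables (k : fieldType) (A : lmodType k).

(* [mu o x y] is x o y. *)
Definition trilin (U : vectType k) (mu : U -> A -> A -> A) : Prop :=
  [/\ forall x y, linear (fun o => mu o x y),
      forall o y, linear (fun x => mu o x y) &
      forall o x, linear (mu o x)].

Definition is_algebra (O : bqr k) (mu : bop O -> A -> A -> A) : Prop :=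
  trilin mu /\
  forall (n m : nat) (a b : 'I_n -> bop O) (c d : 'I_m -> bop O),
    (\sum_(i < n) a i ⊗ b i, \sum_(j < m) c j ⊗ d j) \in brel O ->
    forall x y z : A,
      \sum_(i < n) mu (b i) (mu (a i) x y) z =
      \sum_(j < m) mu (c j) x (mu (d j) y z).

Definition is_abqr_algebra (O : bqr k) (mu : bop O -> A -> A -> A) : Prop :=
  is_abqr O /\ is_algebra mu.

Section Operators.

Variables (U : vectType k) (mu : U -> A -> A -> A).

Definition rota_baxter (lam : k) (P : {linear A -> A}) : Prop :=
  forall o x y,
    mu o (P x) (P y) = P (mu o (P x) y + mu o x (P y) + lam *: mu o x y).

Definition left_rota_baxter (P : {linear A -> A}) : Prop :=
  forall o x y, mu o (P x) (P y) = P (mu o x (P y)).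

Definition right_rota_baxter (P : {linear A -> A}) : Prop :=
  forall o x y, mu o (P x) (P y) = P (mu o (P x) y).

Definition nijenhuis (N : {linear A -> A}) : Prop :=
  forall o x y,
    mu o (N x) (N y) = N (mu o (N x) y + mu o x (N y) - N (mu o x y)).

End Operators.

(* The operations indexed by [tens U V] whose value at o ⊗ e is f o, for every *)
(* pair (e, f) listed in s (the e's forming a basis of V), extended linearly.  *)
Definition ext_op (U V : vectType k) (s : seq (V * (U -> A -> A -> A)))
    (t : tens U V) (x y : A) : A :=
  tlift (fun (o : U) (w : V) =>
    \sum_(i < size (unzip1 s)) coord (in_tuple (unzip1 s)) i w *:
      nth (fun _ _ _ => 0) (unzip2 s) i o x y) t.

Lemma ext_op_pure (U V : vectType k) (s : seq (V * (U -> A -> A -> A)))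
    (i : nat) (o : U) (x y : A) :
  (i < size s)%N -> free (unzip1 s) ->
  (forall (j : nat) a b, (j < size s)%N ->
     linear (fun o' => nth (fun _ _ _ => 0) (unzip2 s) j o' a b)) ->
  ext_op s (o ⊗ (unzip1 s)`_i) x y = nth (fun _ _ _ => 0) (unzip2 s) i o x y.
Proof.
move=> lti frs lins; rewrite /ext_op tlift_pure /=; last first.
  split=> [w | u] a v1 v2; rewrite scaler_sumr -big_split.
    apply: eq_bigr => j _ /=.
    rewrite lins; last by rewrite -(size_map fst) ltn_ord.
    by rewrite scalerDr !scalerA [_ * a]mulrC.
  by apply: eq_bigr => j _ /=; rewrite linearP scalerDl scalerA.
rewrite -(size_map fst) in lti.
have cE j := @coord_free _ _ _ (in_tuple (unzip1 s)) (Ordinal lti) j frs.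
rewrite (bigD1 (Ordinal lti)) //= cE eqxx scale1r big1 ?addr0 // => j nj.
by rewrite cE eq_sym (negPf nj) scale0r.
Qed.

End Algebra.

Section Square.

Variable k : fieldType.

(* (a ⊗ b) ⊗ (c ⊗ d) |-> (a ⊗ c) ⊗ (b ⊗ d) *)
Definition tswap (U V : vectType k) (s : tens U U) (t : tens V V) :
    tens (tens U V) (tens U V) :=
  tlift (fun a b => tlift (fun c d => (a ⊗ c) ⊗ (b ⊗ d)) t) s.

Definition sqrel (U V : vectType k) (f : quad U) (g : quad V) :
    quad (tens U V) :=
  (tswap f.1 g.1, tswap f.2 g.2).

(* The span of all [sqrel f g]; since [sqrel] is bilinear, bases suffice, as   *)
(* recorded in [sqspaceP].                                                     *)
Definition sqspace (U V : vectType k) (L : {vspace quad U})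
    (M : {vspace quad V}) : {vspace quad (tens U V)} :=
  <<[seq sqrel f g | f <- vbasis L, g <- vbasis M]>>%VS.

Definition square (O1 O2 : bqr k) : bqr k :=
  BQR (sqspace (brel O1) (brel O2)).

Lemma tswap_bilin (U V : vectType k) : bilin (@tswap U V).
Proof.
split=> [t | s] a x y; first exact: tlift_is_linear.
rewrite /tswap [in RHS]/tlift scaler_sumr -big_split.
apply: eq_bigr => i _; rewrite scaler_sumr -big_split; apply: eq_bigr => j _ /=.
by rewrite tlift_is_linear scalerDr !scalerA [_ * a]mulrC.
Qed.

Lemma tswap_pure (U V : vectType k) (a b : U) (c d : V) :
  tswap (a ⊗ b) (c ⊗ d) = (a ⊗ c) ⊗ (b ⊗ d).
Proof.
have bl X Y := @tpure_bilin k X Y.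
rewrite /tswap tlift_pure; last first.
  split=> [v | u] e x y; rewrite /tlift scaler_sumr -big_split;
  apply: eq_bigr => i _; rewrite scaler_sumr -big_split; apply: eq_bigr => j _ /=.
    by rewrite (bl _ _).1 (bl _ _).1 scalerDr !scalerA [_ * e]mulrC.
  by rewrite (bl U V).1 (bl _ _).2 scalerDr !scalerA [_ * e]mulrC.
rewrite tlift_pure //.
split=> [v | u] e x y.
  by rewrite (bl U V).2 (bl _ _).1.
by rewrite (bl U V).2 (bl _ _).2.
Qed.

Lemma sqrel_bilin (U V : vectType k) : bilin (@sqrel U V).
Proof.
have [bl br] := tswap_bilin U V.
by split=> [v|u] a x y; rewrite /sqrel /= ?bl ?br.
Qed.

Lemma sqspaceP (U V : vectType k) (L : {vspace quad U}) (M : {vspace quad V})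
    (X : {vspace quad (tens U V)}) :
  (sqspace L M <= X)%VS <->
  (forall f g, f \in L -> g \in M -> sqrel f g \in X).
Proof.
have [bl br] := sqrel_bilin U V.
split=> [sX f g fL gM | hX]; last first.
  by apply/span_subvP=> _ /allpairsP[[f g] /= [/vbasis_mem fL /vbasis_mem gM ->]];
     exact: hX.
rewrite (coord_vbasis fL) (lin_sum _ _ (bl g)) rpred_sum // => i _.
rewrite rpredZ // (coord_vbasis gM) (lin_sum _ _ (br _)) rpred_sum // => j _.
rewrite rpredZ //; apply: (subvP sX); apply: memv_span; apply: allpairs_f;
by rewrite mem_nth // size_tuple.
Qed.

End Square.

Section Types.

Variable k : fieldType.

Definition qpair (U : vectType k) (a b c d : U) : quad U := (a ⊗ b, c ⊗ d).

Lemma basis_delta2 :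
  basis_of {:'rV[k]_2} [:: delta_mx 0 0; delta_mx 0 1].
Proof.
rewrite basisEfree subvf dimvf /dim /= andbT.
apply/(@freeP _ _ _ [tuple _; _]) => c.
rewrite !big_ord_recl big_ord0 /= addr0 => /rowP h i.
have := h i; rewrite !mxE.
by case: i => [[|[|//]] ?]; rewrite /= ?(mulr0, mulr1, addr0, add0r) => <-;
  congr (c _); apply: val_inj.
Qed.

Lemma basis_delta3 :
  basis_of {:'rV[k]_3} [:: delta_mx 0 0; delta_mx 0 1; delta_mx 0 2].
Proof.
rewrite basisEfree subvf dimvf /dim /= andbT.
apply/(@freeP _ _ _ [tuple _; _; _]) => c.
rewrite !big_ord_recl big_ord0 /= addr0 => /rowP h i.
have := h i; rewrite !mxE.
by case: i => [[|[|[|//]]] ?]; rewrite /= ?(mulr0, mulr1, addr0, add0r) => <-;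
  congr (c _); apply: val_inj.
Qed.

Definition T_prec : 'rV[k]_3 := delta_mx 0 0.
Definition T_succ : 'rV[k]_3 := delta_mx 0 1.
Definition T_circ : 'rV[k]_3 := delta_mx 0 2.
Definition T_star : 'rV[k]_3 := T_prec + T_succ + T_circ.

Lemma T_basis : basis_of {:'rV[k]_3} [:: T_prec; T_succ; T_circ].
Proof. exact: basis_delta3. Qed.

Definition tridendriform : bqr k := BQR
  <<[:: qpair T_prec T_prec T_prec T_star;
        qpair T_succ T_prec T_succ T_prec;
        qpair T_star T_succ T_succ T_succ;
        qpair T_succ T_circ T_succ T_circ;
        qpair T_prec T_circ T_circ T_succ;
        qpair T_circ T_prec T_circ T_prec;
        qpair T_circ T_circ T_circ T_circ]>>%VS.

Definition N_prec : 'rV[k]_3 := delta_mx 0 0.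
Definition N_succ : 'rV[k]_3 := delta_mx 0 1.
Definition N_bullet : 'rV[k]_3 := delta_mx 0 2.
Definition N_star : 'rV[k]_3 := N_prec + N_succ + N_bullet.

Lemma N_basis : basis_of {:'rV[k]_3} [:: N_prec; N_succ; N_bullet].
Proof. exact: basis_delta3. Qed.

Definition ns_algebra : bqr k := BQR
  <<[:: qpair N_prec N_prec N_prec N_star;
        qpair N_succ N_prec N_succ N_prec;
        qpair N_star N_succ N_succ N_succ;
        (N_star ⊗ N_bullet + N_bullet ⊗ N_prec,
         N_succ ⊗ N_bullet + N_bullet ⊗ N_star)%R]>>%VS.

Definition L_star : 'rV[k]_2 := delta_mx 0 0.
Definition L_succ : 'rV[k]_2 := delta_mx 0 1.

Lemma L_basis : basis_of {:'rV[k]_2} [:: L_star; L_succ].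
Proof. exact: basis_delta2. Qed.

Definition L_dipterous : bqr k := BQR
  <<[:: qpair L_star L_star L_star L_star;
        qpair L_star L_succ L_succ L_succ;
        qpair L_succ L_star L_succ L_star]>>%VS.

Definition R_star : 'rV[k]_2 := delta_mx 0 0.
Definition R_prec : 'rV[k]_2 := delta_mx 0 1.

Lemma R_basis : basis_of {:'rV[k]_2} [:: R_star; R_prec].
Proof. exact: basis_delta2. Qed.

Definition L_antidipterous : bqr k := BQR
  <<[:: qpair R_star R_star R_star R_star;
        qpair R_prec R_prec R_prec R_star;
        qpair R_star R_prec R_star R_prec]>>%VS.

End Types.

Arguments T_prec {k}.
Arguments T_succ {k}.
Arguments T_circ {k}.
Arguments T_star {k}.
Arguments N_prec {k}.
Arguments N_succ {k}.
Arguments N_bullet {k}.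
Arguments N_star {k}.
Arguments L_star {k}.
Arguments L_succ {k}.
Arguments R_star {k}.
Arguments R_prec {k}.

(* Main.v *)
(* A relation of the square product is, by linearity, a relation of D paired
   with a spanning relation of the second type. For the dendriform and NS types
   the operator maps the product indexed by star to the product of the images:
   P (x [o, star] y) = P x [o] P y. Each spanning relation then reduces to the
   given relation of D with the operator applied to some of x, y, z; only the
   last NS relation needs a cancellation, after which both sides are - N of the
   relations with N on one argument, minus N of the plain relation. For the
   one-sided operators P (x [o, star] y) = P x [o] P y is the hypothesis. *)
Require Import Defs.
From HB Require Import structures.
From mathcomp Require Import all_boot all_order all_algebra.
From mathcomp Require Import ring.

Set Implicit Arguments.
Unset Strict Implicit.
Unset Printing Implicit Defensive.

Import GRing.Theory.
Local Open Scope ring_scope.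

(** * Consequences of linearity for unbundled maps *)

Section LinearProp.

Variables (k : fieldType) (U W : lmodType k) (f : U -> W).
Hypothesis lf : linear f.

Lemma linearProp_add u v : f (u + v) = f u + f v.
Proof. by have := lf 1 u v; rewrite !scale1r. Qed.

Lemma linearProp_scale a u : f (a *: u) = a *: f u.
Proof.
(* A one-term linear combination gives homogeneity without a separate proof that [f 0 = 0]. *)
have := lin_sum (fun _ : 'I_1 => a) (fun=> u) lf.
by rewrite !big_ord1.
Qed.

Lemma linearProp_opp u : f (- u) = - f u.
Proof. by rewrite -scaleN1r linearProp_scale scaleN1r. Qed.

Lemma linearProp_sum n (u : 'I_n -> U) : f (\sum_i u i) = \sum_i f (u i).
Proof.
have := lin_sum (fun=> 1) u lf.
by under eq_bigr do rewrite scale1r; under [RHS]eq_bigr do rewrite scale1r.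
Qed.

End LinearProp.

(** * Tensors as finite sums of pure tensors *)

Section TensorSums.

Variable k : fieldType.
Implicit Types U V : vectType k.

(** Each row of the coefficient matrix contributes one pure tensor. This brings an arbitrary
    relation into the form on which [is_algebra] is stated. *)
Lemma tens_sumP U V (t : tens U V) :
  exists n (a : 'I_n -> U) (b : 'I_n -> V), t = \sum_i a i ⊗ b i.
Proof.
exists (\dim {:U}), (fun i => (vbasis {:U})`_i).
exists (fun i => \sum_j tcoef t i j *: (vbasis {:V})`_j).
rewrite {1}(tens_decomp t); apply: eq_bigr => i _.
by rewrite (lin_sum _ _ ((tpure_bilin _ _).2 _)).
Qed.

Lemma tswap_sum_pure U V n (a b : 'I_n -> U) (p q : V) :
  tswap (\sum_i a i ⊗ b i) (p ⊗ q) = \sum_i (a i ⊗ p) ⊗ (b i ⊗ q).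
Proof.
rewrite (linearProp_sum ((tswap_bilin U V).1 _)).
by apply: eq_bigr => i _; rewrite tswap_pure.
Qed.

End TensorSums.

(** * Evaluating relations, and operations extended from a basis *)

Section Evaluation.

Variables (k : fieldType) (A : lmodType k).

Section Maps.

Variables (U : vectType k) (mu : U -> A -> A -> A).
Hypothesis tri : trilin mu.

(** Going through [tlift] makes each side of a relation linear in the tensor, so that relations can
    be checked on a spanning set. *)
Definition eval_l (t : tens U U) (x y z : A) : A :=
  tlift (fun a b => mu b (mu a x y) z) t.

Definition eval_r (t : tens U U) (x y z : A) : A :=
  tlift (fun c d => mu c x (mu d y z)) t.

Lemma eval_l_sum n (a b : 'I_n -> U) x y z :
  eval_l (\sum_i a i ⊗ b i) x y z = \sum_i mu (b i) (mu (a i) x y) z.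
Proof.
have [lo lx ly] := tri.
rewrite /eval_l (linearProp_sum (tlift_is_linear _)).
apply: eq_bigr => i _; rewrite tlift_pure //.
by split=> [v | u] c s t; rewrite ?lo ?lx.
Qed.

Lemma eval_r_sum n (c d : 'I_n -> U) x y z :
  eval_r (\sum_i c i ⊗ d i) x y z = \sum_i mu (c i) x (mu (d i) y z).
Proof.
have [lo lx ly] := tri.
rewrite /eval_r (linearProp_sum (tlift_is_linear _)).
apply: eq_bigr => i _; rewrite tlift_pure //.
by split=> [v | u] e s t; rewrite ?lo ?ly.
Qed.

End Maps.

Lemma is_algebraP (O : bqr k) (mu : bop O -> A -> A -> A) : trilin mu ->
  (is_algebra mu <->
   forall f, f \in brel O -> forall x y z,
     eval_l mu f.1 x y z = eval_r mu f.2 x y z).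
Proof.
move=> tri; split=> [[_ rel] [s t] | rel].
  have [n [a [b ->]]] := tens_sumP s; have [m [c [d ->]]] := tens_sumP t.
  by move=> fO x y z; rewrite eval_l_sum // eval_r_sum //; apply: rel.
split=> // n m a b c d fO x y z.
by rewrite -eval_l_sum // -eval_r_sum //; apply: (rel _ fO).
Qed.

(** Reduces the relations of the square product to the listed generators of the second type. The
    relation of [mu] is handed over for all arguments at once, so that it can be used with the
    operator applied to some of them. *)
Lemma square_is_algebra (O : bqr k) (mu : bop O -> A -> A -> A)
    (V : vectType k) (gens : seq (quad V)) (nu : tens (bop O) V -> A -> A -> A) :
  is_algebra mu -> trilin nu ->
  (forall (n m : nat) (a b : 'I_n -> bop O) (c d : 'I_m -> bop O),
    (forall x y z, \sum_i mu (b i) (mu (a i) x y) z =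
                   \sum_j mu (c j) x (mu (d j) y z)) ->
    forall g, g \in gens -> forall x y z,
      eval_l nu (tswap (\sum_i a i ⊗ b i) g.1) x y z =
      eval_r nu (tswap (\sum_j c j ⊗ d j) g.2) x y z) ->
  @is_algebra k A (square O (BQR <<gens>>%VS)) nu.
Proof.
move=> [_ rel] tri hgens.
(* The difference of the two sides is linear in the relation, hence vanishes on a span once it
   vanishes on the generators. *)
pose defect x y z (h : quad (tens (bop O) V)) :=
  eval_l nu h.1 x y z - eval_r nu h.2 x y z.
have defect_lin x y z : linear (defect x y z).
  move=> e s t; rewrite /defect /eval_l /eval_r !tlift_is_linear.
  by rewrite scalerBr opprD addrACA.
have defect_span x y z (s : seq (quad (tens (bop O) V))) :
    {in s, forall h, defect x y z h = 0} ->
    {in <<s>>%VS, forall h, defect x y z h = 0}.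
  move=> s0 h hs; rewrite (coord_span (X := in_tuple s) hs).
  rewrite (lin_sum _ _ (defect_lin _ _ _)) big1 // => i _.
  by rewrite s0 ?scaler0 // mem_nth.
apply/is_algebraP => // h hsq x y z; apply/eqP; rewrite -subr_eq0; apply/eqP.
apply: defect_span hsq => _ /allpairsP [[[s t] g] /= [/vbasis_mem fO /vbasis_mem gM ->]].
have [bl br] := sqrel_bilin (bop O) V.
(* [g] is a vector of the basis chosen by [vbasis], which need not be in [gens]; it is expanded over
   [gens]. *)
rewrite (coord_span (X := in_tuple gens) gM) (lin_sum _ _ (br _)).
rewrite (lin_sum _ _ (defect_lin _ _ _)) big1 // => i _.
move: fO; have [n [a [b ->]]] := tens_sumP s.
have [m [c [d ->]]] := tens_sumP t => fO.
rewrite /defect /sqrel /= (hgens _ _ _ _ _ _ (rel _ _ _ _ _ _ fO)).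
  by rewrite subrr scaler0.
by rewrite mem_nth.
Qed.

Lemma ext_op_trilin (U V : vectType k) (s : seq (V * (U -> A -> A -> A))) :
  (forall i, (i < size s)%N -> trilin (nth (fun _ _ _ => 0) (unzip2 s) i)) ->
  trilin (ext_op s).
Proof.
move=> tri.
have {}tri (i : 'I_(size (unzip1 s))) :
    trilin (nth (fun _ _ _ => 0) (unzip2 s) i).
  by apply: tri; rewrite -(size_map fst).
split=> [x y | t y | t x]; first exact: tlift_is_linear.
all: move=> e u v; rewrite /ext_op /tlift scaler_sumr -big_split.
all: apply: eq_bigr => i _; rewrite scaler_sumr -big_split.
all: apply: eq_bigr => j _ /=; rewrite scalerA mulrC -scalerA -scalerDr.
all: congr (_ *: _); rewrite scaler_sumr -big_split.
all: apply: eq_bigr => l _ /=; have [_ lx ly] := tri l.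
all: by rewrite ?lx ?ly scalerDr !scalerA [_ * e]mulrC.
Qed.

Lemma ext_op2 (U V : vectType k) (e1 e2 : V) (f1 f2 : U -> A -> A -> A) :
  free [:: e1; e2] -> trilin f1 -> trilin f2 ->
  let nu := ext_op [:: (e1, f1); (e2, f2)] in
  [/\ trilin nu, forall o x y, nu (o ⊗ e1) x y = f1 o x y &
      forall o x y, nu (o ⊗ e2) x y = f2 o x y].
Proof.
move=> fr t1 t2 nu.
have tri i : (i < 2)%N -> trilin (nth (fun _ _ _ => 0) [:: f1; f2] i).
  by case: i => [|[|]].
split; first exact: ext_op_trilin.
  by move=> o x y; apply: (ext_op_pure (i := 0)) => // j a b /tri[].
by move=> o x y; apply: (ext_op_pure (i := 1)) => // j a b /tri[].
Qed.

Lemma ext_op3 (U V : vectType k) (e1 e2 e3 : V)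
    (f1 f2 f3 : U -> A -> A -> A) :
  free [:: e1; e2; e3] -> trilin f1 -> trilin f2 -> trilin f3 ->
  let nu := ext_op [:: (e1, f1); (e2, f2); (e3, f3)] in
  [/\ trilin nu, forall o x y, nu (o ⊗ e1) x y = f1 o x y,
      forall o x y, nu (o ⊗ e2) x y = f2 o x y &
      forall o x y, nu (o ⊗ e3) x y = f3 o x y].
Proof.
move=> fr t1 t2 t3 nu.
have tri i : (i < 3)%N -> trilin (nth (fun _ _ _ => 0) [:: f1; f2; f3] i).
  by case: i => [|[|[|]]].
split; first exact: ext_op_trilin.
- by move=> o x y; apply: (ext_op_pure (i := 0)) => // j a b /tri[].
- by move=> o x y; apply: (ext_op_pure (i := 1)) => // j a b /tri[].
- by move=> o x y; apply: (ext_op_pure (i := 2)) => // j a b /tri[].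
Qed.

(** Every operation of the theorem has this shape, with the maps chosen among the identity, the
    given operator, scaling by the weight, and minus the operator. *)
Lemma trilin_comp (U : vectType k) (mu : U -> A -> A -> A) (F G H : A -> A) :
  trilin mu -> linear F -> linear G -> linear H ->
  trilin (fun o x y => F (mu o (G x) (H y))).
Proof.
move=> [lo lx ly] lF lG lH.
by split=> [x y | o y | o x] e u v; rewrite ?lG ?lH ?lo ?lx ?ly lF.
Qed.

(** Gives access to the operation at [T_star] and [N_star], which are sums of basis vectors. *)
Lemma ext_op_pureD (U V : vectType k) (s : seq (V * (U -> A -> A -> A)))
    o v w x y :
  ext_op s (o ⊗ (v + w)) x y = ext_op s (o ⊗ v) x y + ext_op s (o ⊗ w) x y.
Proof.
rewrite (linearProp_add ((tpure_bilin _ _).2 _)).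
exact: (linearProp_add (tlift_is_linear _)).
Qed.

Section TswapEvaluation.

Variables (U V : vectType k) (nu : tens U V -> A -> A -> A).
Hypothesis tri : trilin nu.

Lemma eval_l_tswap n (a b : 'I_n -> U) p q x y z :
  eval_l nu (tswap (\sum_i a i ⊗ b i) (p ⊗ q)) x y z =
  \sum_i nu (b i ⊗ q) (nu (a i ⊗ p) x y) z.
Proof. by rewrite tswap_sum_pure eval_l_sum. Qed.

Lemma eval_r_tswap n (c d : 'I_n -> U) p q x y z :
  eval_r nu (tswap (\sum_i c i ⊗ d i) (p ⊗ q)) x y z =
  \sum_i nu (c i ⊗ p) x (nu (d i ⊗ q) y z).
Proof. by rewrite tswap_sum_pure eval_r_sum. Qed.

Lemma eval_l_tswapD s t t' x y z :
  eval_l nu (tswap s (t + t')) x y z =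
  eval_l nu (tswap s t) x y z + eval_l nu (tswap s t') x y z.
Proof.
rewrite (linearProp_add ((tswap_bilin U V).2 _)).
exact: (linearProp_add (tlift_is_linear _)).
Qed.

Lemma eval_r_tswapD s t t' x y z :
  eval_r nu (tswap s (t + t')) x y z =
  eval_r nu (tswap s t) x y z + eval_r nu (tswap s t') x y z.
Proof.
rewrite (linearProp_add ((tswap_bilin U V).2 _)).
exact: (linearProp_add (tlift_is_linear _)).
Qed.

End TswapEvaluation.

End Evaluation.

(** * Associative operations in the types *)

Section Abqr.

Variable k : fieldType.

Lemma square_is_abqr (O1 O2 : bqr k) :
  is_abqr O1 -> is_abqr O2 -> is_abqr (square O1 O2).
Proof.
move=> [s hs] [t ht]; exists (s ⊗ t).
have := (sqspaceP (brel O1) (brel O2) _).1 (subvv _) _ _ hs ht.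
by rewrite /sqrel /= tswap_pure.
Qed.

(** For the trialgebra and NS types, associativity of star is the sum of all spanning relations: on
    either side these expand into the nine products of two basis operations, each exactly once. *)
Lemma sum_mem_span (V : vectType k) (gens : seq V) v :
  v = \sum_(g <- gens) g -> v \in <<gens>>%VS.
Proof. by move=> ->; rewrite big_seq rpred_sum // => g /memv_span. Qed.

Lemma tridendriform_is_abqr : is_abqr (tridendriform k).
Proof.
exists T_star; apply: sum_mem_span.
rewrite !big_cons big_nil; congr pair; apply/matrixP => i j;
by rewrite !mxE /T_star !linearD /=; ring.
Qed.

Lemma ns_algebra_is_abqr : is_abqr (ns_algebra k).
Proof.
exists N_star; apply: sum_mem_span.
rewrite !big_cons big_nil; congr pair; apply/matrixP => i j;
by rewrite !mxE /N_star !linearD /=; ring.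
Qed.

Lemma L_dipterous_is_abqr : is_abqr (L_dipterous k).
Proof. by exists L_star; apply: memv_span; rewrite inE eqxx. Qed.

Lemma L_antidipterous_is_abqr : is_abqr (L_antidipterous k).
Proof. by exists R_star; apply: memv_span; rewrite inE eqxx. Qed.

End Abqr.

Lemma add_cancel_mid (V : zmodType) (p q r s t : V) :
  p + q - r + (r + s - t) = q + p + s - t.
Proof. by rewrite -(addrA r) subrKA (addrC p) addrA. Qed.

(** * The four constructions from operators *)

Section Operators.

Variables (k : fieldType) (O : bqr k) (D : lmodType k).
Variable mu : bop O -> D -> D -> D.
Hypothesis hmu : is_algebra mu.

Let tri : trilin mu := hmu.1.

Let id_lin : linear (fun x : D => x).
Proof. by []. Qed.

Let linear_lin (P : {linear D -> D}) : linear P.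
Proof. exact: linearP. Qed.

Lemma rota_baxter_tridendriform (lam : k) (P : {linear D -> D}) :
  rota_baxter mu lam P ->
  @is_algebra k D (square O (tridendriform k))
    (ext_op [::
      (T_prec, fun o x y => mu o x (P y));
      (T_succ, fun o x y => mu o (P x) y);
      (T_circ, fun o x y => lam *: mu o x y)]).
Proof.
move=> RB.
have lam_lin : linear (fun x : D => lam *: x).
  by move=> e u v; rewrite scalerDr !scalerA mulrC.
have [_ lx ly] := tri.
have [] := ext_op3 (basis_free (T_basis k))
  (trilin_comp tri id_lin id_lin (linear_lin P))
  (trilin_comp tri id_lin (linear_lin P) id_lin)
  (trilin_comp tri lam_lin id_lin id_lin).
set nu := ext_op _ => nu_tri nu_prec nu_succ nu_circ.
have P_star o x y : P (nu (o ⊗ T_star) x y) = mu o (P x) (P y).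
  rewrite RB; congr (P _); rewrite /nu /T_star !ext_op_pureD -/nu.
  by rewrite nu_prec nu_succ nu_circ (addrC (mu o x _)).
apply: (square_is_algebra hmu nu_tri) => n m a b c d rel g.
rewrite !inE => /predU1P[->|/predU1P[->|/predU1P[->|/predU1P[->|
  /predU1P[->|/predU1P[->|/eqP->]]]]]] x y z;
rewrite eval_l_tswap // eval_r_tswap //.
(* In order, the relation of D is used at (x, Py, Pz), (Px, y, Pz), (Px, Py, z), then with factor
   [lam] at (Px, y, z), (x, Py, z), (x, y, Pz), and with [lam] squared at (x, y, z). *)
- under eq_bigr do rewrite !nu_prec.
  under [RHS]eq_bigr do rewrite nu_prec P_star.
  exact: rel.
- under eq_bigr do rewrite nu_prec nu_succ.
  under [RHS]eq_bigr do rewrite nu_prec nu_succ.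
  exact: rel.
- under eq_bigr do rewrite nu_succ P_star.
  under [RHS]eq_bigr do rewrite !nu_succ.
  exact: rel.
- under eq_bigr do rewrite nu_circ nu_succ.
  under [RHS]eq_bigr do
    rewrite nu_circ nu_succ (linearProp_scale (ly _ _)).
  by rewrite -!scaler_sumr rel.
- under eq_bigr do rewrite nu_circ nu_prec.
  under [RHS]eq_bigr do rewrite nu_circ nu_succ.
  by rewrite -!scaler_sumr rel.
- under eq_bigr do rewrite nu_circ nu_prec (linearProp_scale (lx _ _)).
  under [RHS]eq_bigr do rewrite nu_circ nu_prec.
  by rewrite -!scaler_sumr rel.
- under eq_bigr do rewrite !nu_circ (linearProp_scale (lx _ _)).
  under [RHS]eq_bigr do rewrite !nu_circ (linearProp_scale (ly _ _)).
  by rewrite -!scaler_sumr rel.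
Qed.

Lemma nijenhuis_ns_algebra (N : {linear D -> D}) : nijenhuis mu N ->
  @is_algebra k D (square O (ns_algebra k))
    (ext_op [::
      (N_prec, fun o x y => mu o x (N y));
      (N_succ, fun o x y => mu o (N x) y);
      (N_bullet, fun o x y => - N (mu o x y))]).
Proof.
move=> NN.
have oppN_lin : linear (fun x : D => - N x).
  by move=> e u v; rewrite linearP opprD scalerN.
have [_ lx ly] := tri.
have [] := ext_op3 (basis_free (N_basis k))
  (trilin_comp tri id_lin id_lin (linear_lin N))
  (trilin_comp tri id_lin (linear_lin N) id_lin)
  (trilin_comp tri oppN_lin id_lin id_lin).
set nu := ext_op _ => nu_tri nu_prec nu_succ nu_bullet.
have nu_star o x y :
    nu (o ⊗ N_star) x y = mu o x (N y) + mu o (N x) y - N (mu o x y).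
  rewrite /nu /N_star !ext_op_pureD -/nu.
  by rewrite nu_prec nu_succ nu_bullet.
have N_star_mor o x y : N (nu (o ⊗ N_star) x y) = mu o (N x) (N y).
  by rewrite NN nu_star (addrC (mu o x _)).
apply: (square_is_algebra hmu nu_tri) => n m a b c d rel g.
rewrite !inE => /predU1P[->|/predU1P[->|/predU1P[->|/eqP->]]] x y z;
rewrite ?(eval_l_tswapD, eval_r_tswapD) !eval_l_tswap // !eval_r_tswap //.
(* The first three cases use the relation at (x, Ny, Nz), (Nx, y, Nz) and (Nx, Ny, z). *)
- under eq_bigr do rewrite !nu_prec.
  under [RHS]eq_bigr do rewrite nu_prec N_star_mor.
  exact: rel.
- under eq_bigr do rewrite nu_prec nu_succ.
  under [RHS]eq_bigr do rewrite nu_prec nu_succ.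
  exact: rel.
- under eq_bigr do rewrite nu_succ N_star_mor.
  under [RHS]eq_bigr do rewrite !nu_succ.
  exact: rel.
(* Common shape of both sides of the last relation: [u], [v], [w] are the triple products with N on
   the first, second, third argument, and [t] is the plain one. *)
pose S u v w t : D := - N (u + v + w - N t).
have lhsE i : nu (b i ⊗ N_bullet) (nu (a i ⊗ N_star) x y) z +
    nu (b i ⊗ N_prec) (nu (a i ⊗ N_bullet) x y) z =
    S (mu (b i) (mu (a i) (N x) y) z) (mu (b i) (mu (a i) x (N y)) z)
      (mu (b i) (mu (a i) x y) (N z)) (mu (b i) (mu (a i) x y) z).
  (* The product of N(x a y) with z under b occurs with sign minus in the star product and with sign
     plus in the Nijenhuis expansion, and cancels. *)
  rewrite nu_prec !nu_bullet (linearProp_opp (lx _ _)) NN -opprD -linearD.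
  rewrite nu_star !(linearProp_add (lx _ _)) (linearProp_opp (lx _ _)).
  rewrite /S; congr (- N _).
  exact: add_cancel_mid.
have rhsE j : nu (c j ⊗ N_succ) x (nu (d j ⊗ N_bullet) y z) +
    nu (c j ⊗ N_bullet) x (nu (d j ⊗ N_star) y z) =
    S (mu (c j) (N x) (mu (d j) y z)) (mu (c j) x (mu (d j) (N y) z))
      (mu (c j) x (mu (d j) y (N z))) (mu (c j) x (mu (d j) y z)).
  rewrite nu_succ !nu_bullet (linearProp_opp (ly _ _)) NN -opprD -linearD.
  rewrite nu_star !(linearProp_add (ly _ _)) (linearProp_opp (ly _ _)).
  rewrite /S; congr (- N _).
  (* Here the Nijenhuis expansion comes from the first summand, so the two are swapped before
     cancelling. *)
  rewrite addrC (addrC (mu _ (N x) _)) add_cancel_mid.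
  by rewrite [in LHS](addrC _ (mu _ (N x) _)) addrA.
have S_sum p (u v w t : 'I_p -> D) : \sum_i S (u i) (v i) (w i) (t i) =
    S (\sum_i u i) (\sum_i v i) (\sum_i w i) (\sum_i t i).
  by rewrite /S sumrN -linear_sum sumrB !big_split -linear_sum.
(* [S] commutes with sums, so the relation of D applies separately at (Nx, y, z), (x, Ny, z), (x, y,
   Nz) and (x, y, z). *)
rewrite -!big_split (eq_bigr _ (fun i _ => lhsE i)) S_sum !rel -S_sum.
by apply: eq_bigr => j _; rewrite /= rhsE.
Qed.

Lemma left_rota_baxter_L_dipterous (P : {linear D -> D}) :
  left_rota_baxter mu P ->
  @is_algebra k D (square O (L_dipterous k))
    (ext_op [::
      (L_star, fun o x y => mu o x (P y));
      (L_succ, fun o x y => mu o (P x) y)]).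
Proof.
move=> RB.
have [] := ext_op2 (basis_free (L_basis k))
  (trilin_comp tri id_lin id_lin (linear_lin P))
  (trilin_comp tri id_lin (linear_lin P) id_lin).
set nu := ext_op _ => nu_tri nu_star nu_succ.
apply: (square_is_algebra hmu nu_tri) => n m a b c d rel g.
rewrite !inE => /predU1P[->|/predU1P[->|/eqP->]] x y z;
rewrite eval_l_tswap // eval_r_tswap //.
(* The relation is used at (x, Py, Pz), (Px, Py, z) and (Px, y, Pz). *)
- under eq_bigr do rewrite !nu_star.
  under [RHS]eq_bigr do rewrite !nu_star -RB.
  exact: rel.
- under eq_bigr do rewrite nu_star nu_succ -RB.
  under [RHS]eq_bigr do rewrite !nu_succ.
  exact: rel.
- under eq_bigr do rewrite nu_star nu_succ.
  under [RHS]eq_bigr do rewrite nu_star nu_succ.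
  exact: rel.
Qed.

Lemma right_rota_baxter_L_antidipterous (P : {linear D -> D}) :
  right_rota_baxter mu P ->
  @is_algebra k D (square O (L_antidipterous k))
    (ext_op [::
      (R_star, fun o x y => mu o (P x) y);
      (R_prec, fun o x y => mu o x (P y))]).
Proof.
move=> RB.
have [] := ext_op2 (basis_free (R_basis k))
  (trilin_comp tri id_lin (linear_lin P) id_lin)
  (trilin_comp tri id_lin id_lin (linear_lin P)).
set nu := ext_op _ => nu_tri nu_star nu_prec.
apply: (square_is_algebra hmu nu_tri) => n m a b c d rel g.
rewrite !inE => /predU1P[->|/predU1P[->|/eqP->]] x y z;
rewrite eval_l_tswap // eval_r_tswap //.
(* The relation is used at (Px, Py, z), (x, Py, Pz) and (Px, y, Pz). *)
- under eq_bigr do rewrite !nu_star -RB.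
  under [RHS]eq_bigr do rewrite !nu_star.
  exact: rel.
- under eq_bigr do rewrite !nu_prec.
  under [RHS]eq_bigr do rewrite nu_star nu_prec -RB.
  exact: rel.
- under eq_bigr do rewrite nu_star nu_prec.
  under [RHS]eq_bigr do rewrite nu_star nu_prec.
  exact: rel.
Qed.

End Operators.

Theorem theorem5p2 (k : fieldType) (char0 : [pchar k] =i pred0)
    (O : bqr k) (D : lmodType k) (mu : bop O -> D -> D -> D)
    (hD : is_abqr_algebra mu) :
  [/\ forall (lam : k) (P : {linear D -> D}), rota_baxter mu lam P ->
        @is_abqr_algebra k D (square O (tridendriform k))
          (ext_op [::
            (T_prec, fun o x y => mu o x (P y));
            (T_succ, fun o x y => mu o (P x) y);
            (T_circ, fun o x y => lam *: mu o x y)]),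
      forall N : {linear D -> D}, nijenhuis mu N ->
        @is_abqr_algebra k D (square O (ns_algebra k))
          (ext_op [::
            (N_prec, fun o x y => mu o x (N y));
            (N_succ, fun o x y => mu o (N x) y);
            (N_bullet, fun o x y => - N (mu o x y))]),
      forall P : {linear D -> D}, left_rota_baxter mu P ->
        @is_abqr_algebra k D (square O (L_dipterous k))
          (ext_op [::
            (L_star, fun o x y => mu o x (P y));
            (L_succ, fun o x y => mu o (P x) y)])
    & forall P : {linear D -> D}, right_rota_baxter mu P ->
        @is_abqr_algebra k D (square O (L_antidipterous k))
          (ext_op [::
            (R_star, fun o x y => mu o (P x) y);
            (R_prec, fun o x y => mu o x (P y))])].
Proof.
move: hD => [abqrO hmu].
split=> [lam P RB | N NN | P RB | P RB].
- split; last exact: rota_baxter_tridendriform.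
  exact: square_is_abqr (tridendriform_is_abqr k).
- split; last exact: nijenhuis_ns_algebra.
  exact: square_is_abqr (ns_algebra_is_abqr k).
- split; last exact: left_rota_baxter_L_dipterous.
  exact: square_is_abqr (L_dipterous_is_abqr k).
- split; last exact: right_rota_baxter_L_antidipterous.
  exact: square_is_abqr (L_antidipterous_is_abqr k).
Qed.
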